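(* Let $p$ be a prime, let $k\in\mathbb{N}$ be relatively prime to $p$, and let $r$ be the order of $p$ in $(\mathbb{Z}/k\mathbb{Z})^\times$. If $u\in\mathbb{N}$ is relatively prime to $r$ and $\gamma_p(k)\leq p^u$, then \[ v(p,k)\leq 2(p^u-1)+\mathbf{1}_{p^u}(\gamma_p(k)). \]
   Context: Let $F$ be an algebraically closed field of characteristic $p>0$. For $k\in\mathbb{N}$, $v(p,k)$ denotes the smallest natural number $s$ such that every polynomial in $F[t]$ can be written as a sum of at most $s$ $k$-th powers of polynomials in $F[t]$ (with no restriction on the degrees of the polynomials being raised to the $k$-th power); if no such $s$ exists, $v(p,k)=\infty$. For an integer $q\geq 2$, $\gamma_q(k)$ denotes the sum of the digits of the base-$q$ expansion of $k$. The indicator function is $\mathbf{1}_M(x)=1$ if $x=M$ and $\mathbf{1}_M(x)=0$ if $x\neq M$. *)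

(* Defs.v *)
From HB Require Import structures.
From mathcomp Require Import all_boot all_order all_algebra.
Set Implicit Arguments. Unset Strict Implicit. Unset Printing Implicit Defensive.
Import GRing.Theory.
Local Open Scope ring_scope.

(* gamma_q(n): sum of the base-q digits of n.  The i-th digit is (n %/ q^i) %% q;
   for q >= 2 all digits of index >= n vanish, so summing i < n.+1 suffices. *)
Definition digit_sum (q n : nat) : nat :=
  (\sum_(i < n.+1) ((n %/ q ^ i) %% q))%N.

Definition is_mult_order (p k r : nat) : Prop :=
  [/\ (0 < r)%N, (p ^ r = 1 %[mod k])%N &
      forall r' : nat, (0 < r')%N -> (p ^ r' = 1 %[mod k])%N -> (r <= r')%N].

Definition waring_le (F : nzRingType) (k s : nat) : Prop :=
  forall f : {poly F}, exists gs : seq {poly F},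
    (size gs <= s)%N /\ f = \sum_(g <- gs) g ^+ k.

(* Main.v *)
(* Let q = p^u.  Replacing each unit of the base-p digits of k by a suitable
   power of q gives a multiple K = 1 + \sum_(j <- s) q^j of k with as many terms
   as the digit sum of k and with every j = 1 modulo r + 1.  For w a primitive
   (q-1)-th root of unity, B(h) := \sum_i w^-i (1 + w^i h)^K is a combination of
   q - 1 K-th powers, and, K-th powers being products of Frobenius powers,
     - B(h) = [q = 2] + h + \sum_(j <- s) h^(q^j) + [digit sum of k = q] h^K.
   If a generates the multiplicative group of the field with q^(r+1) elements,
   then a^(q^j) = a^q for all j in s, so in B(a h) - a^q B(h) all the h^(q^j)
   cancel at once.  What remains is affine in h with nonzero slope, up to a single
   K-th power when the digit sum of k is q. *)
Require Import Defs.
From HB Require Import structures.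
From mathcomp Require Import all_boot all_order all_algebra.
From mathcomp Require Import cyclic separable cyclotomic ring.

Import GRing.Theory.
Local Open Scope ring_scope.

(** * Multiples of [k] with few terms in base [p ^ u] *)

Section Arithmetic.
Local Open Scope nat_scope.

Lemma digit_expansion p n m : 0 < p -> n < p ^ m ->
  n = \sum_(i < m) (n %/ p ^ i) %% p * p ^ i.
Proof.
move=> p_gt0 lt_n.
suff {lt_n} : n = \sum_(i < m) (n %/ p ^ i) %% p * p ^ i + n %/ p ^ m * p ^ m.
  by rewrite divn_small // mul0n addn0.
elim: m => [|m IHm]; first by rewrite big_ord0 expn0 divn1 muln1.
rewrite big_ord_recr /= {1}IHm -addnA; congr (_ + _).
rewrite expnSr divnMA {1}(divn_eq (n %/ p ^ m) p) mulnDl addnC; congr (_ + _).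
by rewrite -mulnA [p * _]mulnC.
Qed.

(** Each position is listed as often as its base-[p] digit says. Since [p] does not divide [k],
    position 0 occurs; one copy of it is removed and becomes the separate 1. *)
Lemma digit_positions p k : prime p -> coprime k p ->
  exists s : seq nat,
    (size s).+1 = digit_sum p k /\ 1 + \sum_(i <- s) p ^ i = k.
Proof.
move=> p_pr co_kp; have p_gt1 := prime_gt1 p_pr.
pose s0 := flatten [seq nseq ((k %/ p ^ (val i)) %% p) (val i) | i <- enum 'I_k.+1].
have size_s0 : size s0 = digit_sum p k.
  rewrite size_flatten /shape -map_comp sumnE big_map big_enum /=.
  by apply: eq_bigr => i _; rewrite size_nseq.
have sum_s0 : \sum_(i <- s0) p ^ i = k.
  have lt_k : k < p ^ k.+1 := ltnW (ltn_expl k.+1 p_gt1).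
  rewrite big_flatten big_map big_enum /=.
  rewrite [RHS](digit_expansion p k k.+1 (ltnW p_gt1) lt_k).
  by apply: eq_bigr => i _; rewrite big_nseq iter_addn_0 mulnC.
have in0 : 0 \in s0.
  apply/flattenP; exists (nseq (k %% p) 0).
    by apply/mapP; exists ord0; rewrite ?mem_enum //= expn0 divn1.
  by rewrite mem_nseq eqxx andbT lt0n -/(p %| k) -prime_coprime // coprime_sym.
exists (rem 0 s0); split.
  by rewrite size_rem // prednK // -has_predT; apply/hasP; exists 0.
by rewrite -[RHS]sum_s0 (big_rem 0 in0) /= expn0.
Qed.

Lemma mod_inverse_exists u r : 0 < r -> coprime u r ->
  exists v, u * v = 1 %[mod r].
Proof.
move=> r_gt0 co_ur; exists (u ^ (totient r).-1).
by rewrite -expnS prednK ?totient_gt0 // Euler_exp_totient.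
Qed.

Lemma expn_mod_order p k r m n : p ^ r = 1 %[mod k] -> m = n %[mod r] ->
  p ^ m = p ^ n %[mod k].
Proof.
move=> pr1.
have red l : p ^ l = p ^ (l %% r) %[mod k].
  rewrite {1}(divn_eq l r) expnD mulnC [_ * r]mulnC expnM.
  by rewrite -modnMmr -modnXm pr1 modnXm exp1n modnMmr muln1.
by move=> mn; rewrite red mn -red.
Qed.

(* The powers of p modulo k only depend on exponents modulo r; multiplication
   by u permutes these residues, and the exponents can moreover be prescribed
   modulo r + 1, which is prime to r. *)
Lemma sparse_multiple p k r u : prime p -> coprime k p ->
  0 < r -> p ^ r = 1 %[mod k] -> coprime u r ->
  exists s : seq nat, [/\ (size s).+1 = digit_sum p k,
    k %| 1 + \sum_(j <- s) (p ^ u) ^ j & all (fun j => j %% r.+1 == 1) s].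
Proof.
move=> p_pr co_kp r_gt0 pr1 co_ur.
have [s [size_s sum_s]] := digit_positions p k p_pr co_kp.
have [v uv] := mod_inverse_exists u r r_gt0 co_ur.
have co_r : coprime r r.+1 by rewrite coprimenS.
(* As [u * j i] is congruent to [i] modulo [r], trading [p ^ i] for [(p ^ u) ^ j i] changes nothing
   modulo [k]. *)
pose j i := chinese r r.+1 (v * i) 1.
exists (map j s); split; first by rewrite size_map.
- rewrite /dvdn -[X in _ == X](modnn k) -[X in _ == X %% _]sum_s big_map.
  rewrite -modnDmr -[X in _ == X]modnDmr; apply/eqP; congr ((1 + _) %% k).
  elim: s {size_s sum_s} => [|i s IHs]; first by rewrite !big_nil.
  rewrite !big_cons -modnDm IHs modnDmr -[RHS]modnDml; congr ((_ + _) %% k).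
  rewrite -expnM; apply: (expn_mod_order p k r) => //.
  by rewrite -modnMmr chinese_modl // modnMmr mulnA -modnMml uv modnMml mul1n.
- apply/allP => _ /mapP[i _ ->]; rewrite chinese_modr //.
  by rewrite modn_small // ltnS.
Qed.

End Arithmetic.

(** * Roots of unity and extraction of coefficients *)

Lemma closed_prim_root_exists (F : closedFieldType) n :
  (0 < n)%N -> n%:R != 0 :> F -> exists z : F, n.-primitive_root z.
Proof.
move=> n_gt0 nF.
have [s def_s] := closed_field_poly_normal ('X^n - 1 : {poly F}).
have lead1 : lead_coef ('X^n - 1 : {poly F}) = 1.
  by apply/eqP; rewrite -monicE -[1]/(1%:P) monicXnsubC.
rewrite lead1 scale1r in def_s.
have uniq_s : uniq s.
  by rewrite -separable_prod_XsubC -def_s separable_Xn_sub_1.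
have size_s : size s = n.
  by apply: succn_inj; rewrite -(size_prod_XsubC _ id) -def_s size_Xn_sub_1.
have roots_s : all n.-unity_root s.
  by apply/allP => x xs; rewrite /root_of_unity def_s root_prod_XsubC.
have /hasP[z _ zP] := has_prim_root n_gt0 roots_s uniq_s (eq_leq (esym size_s)).
by exists z.
Qed.

Lemma sum_expr_prim_root (R : idomainType) n (z : R) m :
  n.-primitive_root z ->
  \sum_(i < n) z ^+ m ^+ i = (if (n %| m)%N then n%:R else 0).
Proof.
move=> prim_z; rewrite (prim_order_dvd prim_z); case: eqP => [-> | /eqP zm].
  under eq_bigr => i _ do rewrite expr1n.
  by rewrite sumr_const card_ord.
apply/eqP; have /eqP := subrX1 (z ^+ m) n.
rewrite exprAC (prim_expr_order prim_z) expr1n subrr eq_sym mulf_eq0.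
by rewrite subr_eq0 (negPf zm).
Qed.

Section LinearProduct.
Variables (R : comNzRingType) (s : seq R).
Let P : {poly R} := \prod_(a <- s) (1 + a *: 'X).

Lemma horner_prod_linear x : P.[x] = \prod_(a <- s) (1 + x * a).
Proof.
rewrite horner_prod; apply: eq_bigr => a _.
by rewrite hornerD hornerC hornerZ hornerX mulrC.
Qed.

(** Indices 0, 1 and the top one are the only ones that can survive in [polarization]. *)
Lemma prod_linear_coefs :
  [/\ P`_0 = 1, P`_1 = \sum_(a <- s) a, P`_(size s) = \prod_(a <- s) a &
      (size P <= (size s).+1)%N].
Proof.
rewrite /P; elim: s => [|a s' [IH0 IH1 IHs IHP]].
  by rewrite !big_nil !coef1 size_poly1.
set Q := \prod_(b <- s') _ in IH0 IH1 IHs IHP.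
have coefS i : ((1 + a *: 'X) * Q)`_i.+1 = Q`_i.+1 + a * Q`_i.
  by rewrite mulrDl mul1r -scalerAl coefD coefZ coefXM.
rewrite !big_cons -/Q !coefS IH0 IH1 IHs mulr1 (addrC a); split=> //.
- by rewrite mulrDl mul1r -scalerAl coefD coefZ coefXM mulr0 addr0.
- by rewrite nth_default ?add0r.
- rewrite mulrDl mul1r -scalerAl (leq_trans (size_polyD _ _)) //.
  rewrite geq_max (leq_trans IHP) //= (leq_trans (size_scale_leq _ _)) //.
  by rewrite (leq_trans (size_polyMleq _ _)) // size_polyX.
Qed.

End LinearProduct.

(* Weighting by z^-i, written z^(i(n-1)), extracts the coefficients of index
   congruent to 1 modulo n from the product, seen as a polynomial in z^i of
   degree at most n + 1: this is index 1, index n + 1, and index 0 if n = 1. *)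
Lemma polarization (R : idomainType) n (z : R) (s : seq R) :
  n.-primitive_root z -> (size s <= n.+1)%N ->
  \sum_(i < n) z ^+ (i * n.-1) * \prod_(a <- s) (1 + z ^+ i * a)
  = n%:R * ((n == 1)%:R + \sum_(a <- s) a
            + (size s == n.+1)%:R * \prod_(a <- s) a).
Proof.
move=> prim_z le_s; have n_gt0 := prim_order_gt0 prim_z.
have [] := prod_linear_coefs _ s; set P := \prod_(a <- s) (1 + _) => P0 P1 Ps szP.
have szP' : (size P <= n.+2)%N by rewrite (leq_trans szP).
under [LHS]eq_bigr => i _ do
  rewrite -horner_prod_linear (horner_coef_wide _ szP') mulr_sumr.
rewrite exchange_big /=.
have inner m : \sum_(i < n) z ^+ (i * n.-1) * (P`_m * z ^+ i ^+ m)
    = P`_m * (if (n %| n.-1 + m)%N then n%:R else 0).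
  rewrite -(sum_expr_prim_root _ _ _ _ prim_z) mulr_sumr; apply: eq_bigr => i _.
  by rewrite mulrCA -!exprM -exprD mulnDl ![(i * _)%N]mulnC.
under eq_bigr => m _ do rewrite inner.
rewrite big_ord_recl big_ord_recr; case: n n_gt0 {prim_z inner} le_s szP' => // n _.
move=> le_s szP'.
(* The order is now [n.+1]. Besides 0, 1 and [n.+2], the indices run from 2 to [n.+1]; adding [n]
   puts them strictly between [n.+1] and its double. *)
rewrite big_ord_recl big1 /= => [|i _]; last first.
  rewrite /= /bump /= !add1n (_ : n + i.+2 = n.+1 + i.+1)%N; last first.
    by rewrite addnS addSn.
  by rewrite dvdn_addr ?dvdnn // gtnNdvd ?mulr0 // ltnS ltn_ord.
have dvd0 : (n.+1 %| n)%N = (n.+1 == 1)%N by case: n {le_s szP'} => // n; rewrite gtnNdvd.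
have dvdS : (n.+1 %| n + n.+2)%N by rewrite addnS -addSn dvdn_addr.
have top : P`_n.+2 = (size s == n.+2)%:R * \prod_(a <- s) a.
  case: eqP => [<- | /eqP ne_s]; first by rewrite mul1r.
  by rewrite mul0r nth_default // (leq_trans szP) // ltn_neqAle ne_s.
rewrite /bump /= !add1n addn0 addn1 dvdnn dvd0 dvdS P0 P1 top addr0 -addrA.
by rewrite !mulrDr [n.+1%:R * (\sum_(_ <- _) _)]mulrC [n.+1%:R * (_ * _)]mulrC;
  case: eqP; rewrite ?mul1r ?mulr1 ?mulr0.
Qed.

(** * Frobenius powers and weighted sums of powers *)

Lemma exprD_pow_pchar (R : comNzRingType) p n (x y : R) :
  prime p -> p \in [pchar R] -> (x + y) ^+ (p ^ n) = x ^+ (p ^ n) + y ^+ (p ^ n).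
Proof.
by move=> p_pr pR; rewrite exprDn_pchar // pnatX pnatE // pR.
Qed.

Lemma closed_field_root (F : closedFieldType) k (c : F) :
  (0 < k)%N -> exists x, x ^+ k = c.
Proof.
move=> k_gt0; have /closed_rootP[x] : size ('X^k - c%:P) != 1%N.
  by rewrite size_XnsubC // eqSS -lt0n.
by rewrite rootE !hornerE subr_eq0 => /eqP; exists x.
Qed.

(** Every coefficient has a [k]-th root in [F], which is absorbed into the base. *)
Lemma waring_of_multiple (F : closedFieldType) k K s (f : {poly F})
    (l : seq (F * {poly F})) :
  (0 < k)%N -> (k %| K)%N -> (size l <= s)%N ->
  f = \sum_(ch <- l) ch.1 *: ch.2 ^+ K ->
  exists gs : seq {poly F}, (size gs <= s)%N /\ f = \sum_(g <- gs) g ^+ k.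
Proof.
move=> k_gt0 /dvdnP[m ->] le_l ->.
elim: l s le_l => [|[c h] l IHl] [|s] //= le_l.
- by exists [::]; rewrite !big_nil.
- by exists [::]; rewrite !big_nil.
have [gs [le_gs eq_gs]] := IHl s le_l.
have [x xk] := closed_field_root F k c k_gt0.
exists (x *: h ^+ m :: gs); split=> //.
by rewrite !big_cons eq_gs exprZn xk exprM.
Qed.

Lemma natr_pchar_pred (R : nzRingType) p m :
  p \in [pchar R] -> (0 < m)%N -> (p ^ m - 1)%:R = -1 :> R.
Proof.
move=> pR m_gt0; have p_gt0 := prime_gt0 (pcharf_prime pR).
by rewrite natrB ?expn_gt0 ?p_gt0 // natrX (pcharf0 pR) expr0n gtn_eqF // sub0r.
Qed.

Lemma expr_pow_fixed (R : pzRingType) q j (x : R) : x ^+ q = x -> x ^+ (q ^ j) = x.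
Proof. by move=> xq; elim: j => // j IHj; rewrite expnSr exprM IHj. Qed.

(** Powers of [w] are fixed by the [q]-th power map, so the [K]-th power is a product of factors
    [1 + w ^+ i *: h ^+ (q ^ j)]. Then [polarization] applies with [n = q - 1], which is -1 in
    [F]. *)
Lemma power_block (F : fieldType) p u q (w : F) (s : seq nat) (h : {poly F}) :
  p \in [pchar F] -> (0 < u)%N -> q = (p ^ u)%N -> (size s <= q)%N ->
  (q - 1).-primitive_root w ->
  let K := (\sum_(j <- s) q ^ j)%N in
  \sum_(i < q - 1) w ^+ (i * (q - 1).-1) *: (1 + w ^+ i *: h) ^+ K
  = - ((q == 2)%:R + \sum_(j <- s) h ^+ (q ^ j) + (size s == q)%:R * h ^+ K).
Proof.
move=> pF u_gt0 q_def le_s prim_w K; have p_pr := pcharf_prime pF.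
have pP : p \in [pchar {poly F}] by rewrite pchar_poly.
have qE : q = (q - 1).+1 by rewrite subn1 prednK // q_def expn_gt0 prime_gt0.
have wq i : (w ^+ i) ^+ q = w ^+ i.
  by rewrite qE exprS -exprM mulnC exprM (prim_expr_order prim_w) expr1n mulr1.
have onePq j (y : {poly F}) : (1 + y) ^+ (q ^ j) = 1 + y ^+ (q ^ j).
  by rewrite q_def -expnM exprD_pow_pchar // expr1n.
have prim_wP : (q - 1).-primitive_root w%:P by rewrite fmorph_primitive_root.
have natr_q : (q - 1)%:R = -1 :> {poly F} by rewrite q_def (natr_pchar_pred _ p).
have := polarization _ _ _ [seq h ^+ (q ^ j) | j <- s] prim_wP.
rewrite size_map -qE natr_q mulN1r !big_map -expr_sum => /(_ le_s).
rewrite -[(q - 1 == 1)%N]eqSS -qE => <-; apply: eq_bigr => i _.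
rewrite big_map expr_sum -mul_polyC rmorphXn; congr (_ * _); apply: eq_bigr => j _.
by rewrite onePq exprZn expr_pow_fixed // -mul_polyC rmorphXn.
Qed.

(** * Assembling the representation of [f] *)

Theorem theorem3 (F : closedFieldType) (p k r u : nat) :
  prime p -> p \in [pchar F]%R ->
  coprime k p -> is_mult_order p k r ->
  coprime u r -> (digit_sum p k <= p ^ u)%N ->
  waring_le F k (2 * (p ^ u - 1) + (digit_sum p k == p ^ u))%N.
Proof.
move=> p_pr pF co_kp [r_gt0 pr1 _] co_ur le_q f.
have k_gt0 : (0 < k)%N.
  by case: k co_kp {pr1 le_q} => //; rewrite /coprime gcd0n; case: p p_pr {pF} => [|[]].
have [s [size_s dvd_K js1]] := sparse_multiple p k r u p_pr co_kp r_gt0 pr1 co_ur.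
have q_gt0 : (0 < p ^ u)%N by rewrite expn_gt0 prime_gt0.
(* An empty [s] forces [k = 1], where [f] itself is the only term; if [p ^ u = 1], the indicator
   provides for it. *)
have [s0 | s_neq0] := eqVneq s [::].
  move: dvd_K size_s; rewrite s0 big_nil dvdn1 => /eqP-> <-.
  exists [:: f]; rewrite big_seq1 expr1; split=> //=.
  by case: (p ^ u)%N q_gt0 => [|[|q]] //= _; rewrite subn1 addn0 muln_gt0.
have u_gt0 : (0 < u)%N.
  case: u le_q {co_ur dvd_K q_gt0} => //; rewrite -size_s expn0 ltnS leqn0.
  by rewrite size_eq0 (negPf s_neq0).
have q_gt1 : (1 < p ^ u)%N by rewrite -(expn0 p) ltn_exp2l ?prime_gt1.
set q := (p ^ u)%N in q_gt0 q_gt1 le_q dvd_K *.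
have natr_neq0 m : (0 < m)%N -> (p ^ m - 1)%:R != 0 :> F.
  by move=> m_gt0; rewrite natr_pchar_pred // oppr_eq0 oner_eq0.
have [w prim_w] : exists w : F, (q - 1).-primitive_root w.
  by apply: closed_prim_root_exists; rewrite ?subn_gt0 ?natr_neq0.
have lt_qd : (q - 1 < q ^ r.+1 - 1)%N.
  by rewrite ltn_sub2rE // -{1}(expn1 q) ltn_exp2l.
have [a prim_a] : exists a : F, (q ^ r.+1 - 1).-primitive_root a.
  apply: closed_prim_root_exists; first exact: leq_ltn_trans lt_qd.
  by rewrite /q -expnM natr_neq0 // muln_gt0 u_gt0.
have aqd : a ^+ (q ^ r.+1) = a.
  have qd_gt0 : (0 < q ^ r.+1)%N by rewrite expn_gt0 q_gt0.
  by rewrite -[in LHS](subnK qd_gt0) exprD (prim_expr_order prim_a) mul1r.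
have a_neq0 : a != 0.
  by rewrite (prim_root_eq0 prim_a) -lt0n (leq_ltn_trans _ lt_qd).
(* The order of [a] exceeds [q - 1], so the slope is nonzero. *)
have aq : a - a ^+ q != 0.
  apply/eqP => /eqP; rewrite subr_eq0 -[X in _ ^+ X](subnK q_gt0) exprD.
  rewrite -[X in X == _]mul1r (inj_eq (mulIf a_neq0)) eq_sym.
  by rewrite -(prim_order_dvd prim_a) gtnNdvd // subn_gt0.
have aqj j : j \in s -> a ^+ (q ^ j) = a ^+ q.
  move=> /(allP js1) /eqP j1.
  rewrite [j in LHS](divn_eq j r.+1) j1 addn1 expnSr exprM [(_ * r.+1)%N]mulnC.
  by rewrite expnM (expr_pow_fixed _ _ _ _ aqd).
set K := (1 + _)%N in dvd_K.
(* The summand 1 is [q ^ 0]; it produces the linear term of a block. *)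
have KE : K = (\sum_(j <- 0%N :: s) q ^ j)%N by rewrite big_cons.
pose e := (digit_sum p k == q); pose b := a - a ^+ q.
(* This solves [f = b *: g + constant], the constant being what the two blocks leave when
   [q = 2]. *)
pose g := b^-1 *: (f - (q == 2)%:R *: (1 - a ^+ q)%:P).
pose bl c (h : {poly F}) :=
  [seq (c * w ^+ (i * (q - 1).-1), 1 + w ^+ i *: h) | i <- index_iota 0 (q - 1)].
have sum_bl c h : \sum_(ch <- bl c h) ch.1 *: ch.2 ^+ K =
  - c *: ((q == 2)%:R + h + \sum_(j <- s) h ^+ (q ^ j) + e%:R * h ^+ K).
  rewrite big_map big_mkord KE.
  have := power_block F p u q w (0%N :: s) h pF u_gt0 erefl _ prim_w.
  rewrite /= size_s => /(_ le_q).
  rewrite [\sum_(j <- _) h ^+ _]big_cons expn0 expr1 addrA => eq_h.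
  rewrite scaleNr -scalerN -/e -eq_h scaler_sumr.
  by apply: eq_bigr => i _; rewrite scalerA.
(* Two blocks of [q - 1] terms, and for [e = 1] one more term cancelling the leftover multiple of
   [g ^+ K]. *)
apply: (waring_of_multiple _ _ K _ _ (bl (a ^+ q) g ++ bl (-1) (a *: g) ++
   nseq e (a ^+ q - a ^+ K, g))) => //.
  by rewrite !size_cat !size_map size_nseq size_iota subn0 addnA addnn mul2n.
rewrite !big_cat /= !sum_bl.
have -> : \sum_(ch <- nseq e (a ^+ q - a ^+ K, g)) ch.1 *: ch.2 ^+ K
    = e%:R *: ((a ^+ q - a ^+ K) *: g ^+ K).
  by rewrite big_nseq; case: (e); rewrite /= ?addr0 ?scale1r ?scale0r.
have eq_f : f = b *: g + (q == 2)%:R *: (1 - a ^+ q)%:P.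
  by rewrite scalerA mulfV // scale1r subrK.
have -> : \sum_(j <- s) (a *: g) ^+ (q ^ j) = a ^+ q *: \sum_(j <- s) g ^+ (q ^ j).
  rewrite scaler_sumr !big_seq; apply: eq_bigr => j js.
  by rewrite exprZn aqj.
clearbody g; rewrite {1}eq_f exprZn /b -!mul_polyC !(polyCB, polyCN) polyC1.
rewrite polyC_natr.
set S := \sum_(j <- s) _; set E := e%:R; set Q := (_ == 2)%:R.
ring.
Qed.
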